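(* Let $f : \mathbb{E}\to\mathbb{R}$ be a twice differentiable function with positive definite Hessian that is strongly self-concordant with constant $M \ge 0$, and let $\mu, L > 0$ be such that $\mu B \preceq \nabla^2 f(x) \preceq LB$ for all $x \in \mathbb{E}$. Let $(x_k)_{k\ge0}$, $(G_k)_{k\ge0}$ be generated by the quasi-Newton scheme described in the context (with arbitrary $u_k \in \mathbb{E}$, $\tau_k \in [0,1]$). Suppose the initial point $x_0$ is sufficiently close to the solution: $$M\lambda_f(x_0) \leq \frac{\ln\frac32}{4}\,\frac{\mu}{L}.$$ Then, for all $k \geq 0$, we have $$\nabla^2 f(x_k) \preceq G_k \preceq e^{2M\sum_{i=0}^{k-1}\lambda_f(x_i)}\,\frac{L}{\mu}\,\nabla^2 f(x_k) \preceq \frac{3L}{2\mu}\nabla^2 f(x_k),$$ and $$\lambda_f(x_k) \leq \left(1 - \frac{\mu}{2L}\right)^k\lambda_f(x_0).$$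
   Context: $\mathbb{E}$ is an $n$-dimensional real vector space, $\mathbb{E}^*$ its dual, and $\langle s, x\rangle$ is the value of $s \in \mathbb{E}^*$ at $x \in \mathbb{E}$. The gradient $\nabla f(x)$ belongs to $\mathbb{E}^*$ and the Hessian $\nabla^2 f(x)$ is a self-adjoint linear operator $\mathbb{E}\to\mathbb{E}^*$. For self-adjoint $A, A_1 : \mathbb{E} \to \mathbb{E}^*$, $A \preceq A_1$ means $\langle (A_1 - A)h, h\rangle \ge 0$ for all $h \in \mathbb{E}$. For $x, h\in\mathbb{E}$, $\|h\|_x = \langle\nabla^2 f(x)h,h\rangle^{1/2}$. The local norm of the gradient is $\lambda_f(x) = \langle\nabla f(x),\nabla^2 f(x)^{-1}\nabla f(x)\rangle^{1/2}$. For $u \in \mathbb{E}$, $u^*$ denotes the map $s \mapsto \langle s, u\rangle$ on $\mathbb{E}^*$; thus $uu^* : \mathbb{E}^*\to\mathbb{E}$ is $s \mapsto \langle s,u\rangle u$, and e.g. $Auu^*G$ is the operator $\mathbb{E}\to\mathbb{E}^*$, $h \mapsto \langle Gh, u\rangle Au$. A basis $e_1,\dots,e_n$ of $\mathbb{E}$ is fixed, and $B = \left(\sum_{i=1}^n e_ie_i^*\right)^{-1} : \mathbb{E}\to\mathbb{E}^*$. A twice differentiable function $f : \mathbb{E}\to\mathbb{R}$ with positive definite Hessian is strongly self-concordant with constant $M \ge 0$ if $$\nabla^2 f(y) - \nabla^2 f(x) \preceq M\|y-x\|_z\,\nabla^2 f(w)\quad\text{for all } x,y,z,w\in\mathbb{E}.$$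 For self-adjoint positive definite $A$, self-adjoint $G$ with $A \preceq G$, $u \in \mathbb{E}$ and $\tau \in \mathbb{R}$: if $Gu \ne Au$, define $$\mathrm{Broyd}_\tau(G,A,u) = \tau\left[G - \frac{Auu^*G + Guu^*A}{\langle Au,u\rangle} + \left(\frac{\langle Gu,u\rangle}{\langle Au,u\rangle}+1\right)\frac{Auu^*A}{\langle Au,u\rangle}\right] + (1-\tau)\left[G - \frac{(G-A)uu^*(G-A)}{\langle (G-A)u,u\rangle}\right],$$ and if $Gu = Au$, define $\mathrm{Broyd}_\tau(G,A,u) = G$. Quasi-Newton scheme: choose $x_0 \in \mathbb{E}$ and set $G_0 = LB$. For $k \ge 0$: (1) $x_{k+1} = x_k - G_k^{-1}\nabla f(x_k)$; (2) compute $r_k = \|x_{k+1}-x_k\|_{x_k}$ and set $\tilde{G}_k = (1+Mr_k)G_k$; (3) choose $u_k\in\mathbb{E}$ and $\tau_k\in[0,1]$; (4) $G_{k+1} = \mathrm{Broyd}_{\tau_k}(\tilde{G}_k,\nabla^2 f(x_{k+1}),u_k)$. (The scheme is well-defined, since $\nabla^2 f(x_{k+1}) \preceq \tilde{G}_k$ for all $k$.) *)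

(* Defs.v *)
From HB Require Import structures.
From mathcomp Require Import all_boot all_order all_algebra.
From mathcomp Require Import all_classical all_reals all_analysis.

Set Implicit Arguments.
Unset Strict Implicit.
Unset Printing Implicit Defensive.

Import Order.TTheory GRing.Theory Num.Theory.
Import numFieldNormedType.Exports.
Import VectorInternalTheory.

Local Open Scope ring_scope.

(* Frechet differentiability between abstract finite-dimensional real vector
   spaces.  A vectType carries no topology, so the library notions are applied
   in the coordinates given by the linear isomorphism v2r : V -> 'rV_(dim V);
   all norms on a finite-dimensional space being equivalent, neither the
   differentiability nor the differential depends on this choice. *)
Section Frechet.
Context {R : realType} {V W : vectType R}.

Definition in_coord (F : V -> W) : 'rV[R]_(dim V) -> 'rV[R]_(dim W) :=
  v2r \o F \o r2v.

Definition vdifferentiable (F : V -> W) (x : V) : Prop :=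
  differentiable (in_coord F) (v2r x).

(* Meaningful when F is differentiable at x; see vdiffE. *)
Definition vdiff (F : V -> W) (x : V) : 'Hom(V, W) :=
  linfun (r2v \o 'd (in_coord F) (v2r x) \o v2r).

Lemma vdiffE (F : V -> W) (x h : V) :
  vdiff F x h = r2v ('d (in_coord F) (v2r x) (v2r h)).
Proof. by rewrite lfunE. Qed.

End Frechet.

Section Operators.
Context {R : realType} {E : vectType R}.

Local Notation Es := 'Hom(E, R^o).

Definition pairing (s : Es) (x : E) : R := s x.

Local Notation "<< s , x >>" := (pairing s x).

(* Self-adjointness is not bundled with the order or with positive
   definiteness: for the Hessian it follows from twice differentiability. *)
Definition loewner_le (A G : 'Hom(E, Es)) : Prop :=
  forall h : E, 0 <= << (G - A) h, h >>.

Definition posdef (A : 'Hom(E, Es)) : Prop :=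
  forall h : E, h != 0 -> 0 < << A h, h >>.

(* the operator u u^* : E^* -> E *)
Definition dyad (u : E) : 'Hom(Es, E) := linfun (fun s : Es => << s, u >> *: u).

Lemma dyadE (u : E) (s : Es) : dyad u s = << s, u >> *: u.
Proof.
rewrite /dyad; pose g (s : Es) := << s, u >> *: u.
have g_lin : linear g.
  by move=> a s1 s2; rewrite /g /pairing !lfunE /= lfunE /= scalerDl scalerA.
pose gl : {linear Es -> E} := HB.pack g (GRing.isLinear.Build _ _ _ _ g g_lin).
by rewrite -[LHS]/(linfun gl s) lfunE.
Qed.

(* f^-1%VF is the genuine inverse whenever the linear map f is bijective *)
Definition basis_op n (e : n.-tuple E) : 'Hom(E, Es) :=
  ((\sum_(i < n) dyad (tnth e i))^-1)%VF.

(* The order of composition of lfun is the usual one: (f \o g) x = f (g x). *)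
Definition Broyd (tau : R) (G A : 'Hom(E, Es)) (u : E) : 'Hom(E, Es) :=
  if G u == A u then G else
    tau *: (G
            - << A u, u >>^-1 *:
                ((A \o dyad u \o G)%VF + (G \o dyad u \o A)%VF)
            + ((<< G u, u >> / << A u, u >> + 1) / << A u, u >>) *:
                (A \o dyad u \o A)%VF)
    + (1 - tau) *: (G
            - << (G - A) u, u >>^-1 *: ((G - A) \o dyad u \o (G - A))%VF).

End Operators.

Section Functions.
Context {R : realType} {E : vectType R}.
Implicit Types (f : E -> R) (x h : E).

Local Notation Es := 'Hom(E, R^o).

Definition gradient f x : Es := vdiff (f : E -> R^o) x.

Definition hessian f x : 'Hom(E, Es) := vdiff (gradient f) x.

Definition twice_differentiable f : Prop :=
  (forall x, vdifferentiable (f : E -> R^o) x) /\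
  (forall x, vdifferentiable (gradient f) x).

Definition local_norm f x h : R := Num.sqrt (pairing (hessian f x h) h).

Definition local_grad_norm f x : R :=
  Num.sqrt (pairing (gradient f x) ((hessian f x)^-1%VF (gradient f x))).

Definition strongly_self_concordant f (M : R) : Prop :=
  forall x y z w : E,
    loewner_le (hessian f y - hessian f x)
               ((M * local_norm f z (y - x)) *: hessian f w).

Definition quasi_newton_scheme n (e : n.-tuple E) f (M L : R)
    (x : nat -> E) (G : nat -> 'Hom(E, Es)) (u : nat -> E) (tau : nat -> R) :
    Prop :=
  G 0%N = L *: basis_op e /\
  forall k : nat,
    [/\ x k.+1 = x k - (G k)^-1%VF (gradient f (x k)),
        0 <= tau k <= 1
      & G k.+1 = Broyd (tau k)
                   ((1 + M * local_norm f (x k) (x k.+1 - x k)) *: G k)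
                   (hessian f (x k.+1)) (u k)].

End Functions.

(* Main.v *)
Require Import Defs.
From HB Require Import structures.
From mathcomp Require Import all_boot all_order all_algebra.
From mathcomp Require Import all_classical all_reals all_analysis.
From mathcomp Require Import ring lra.

Import Order.TTheory GRing.Theory Num.Theory.
Import numFieldNormedType.Exports.
Import VectorInternalTheory.
Set Implicit Arguments. Unset Strict Implicit. Unset Printing Implicit Defensive.
Local Open Scope ring_scope.
(** The proof is an induction on k that carries the two-sided bound
    H_k <= G_k <= eta_k H_k, where H_k is the Hessian at x_k and
    eta_k = exp (2 M (lambda_0 + ... + lambda_(k-1))) L / mu, together with the
    geometric decay of lambda_k, the local norm of the gradient at x_k.

    The bound on G_k survives a step for two reasons.  Strong self-concordance
    makes the Hessians at consecutive points comparable up to a factor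
    1 + M r_k, where r_k <= lambda_k is the local length of the step; the
    correction of G_k by 1 + M r_k therefore restores H_(k+1) <= G_k, and costs
    at most (1 + M r_k)^2 <= exp (2 M lambda_k) on the upper side.  The Broyden
    update then keeps every two-sided bound in terms of its target operator
    ([Broyd_loewner]): it is a convex combination of the DFP update, which in the
    A-orthogonal decomposition along u replaces the u-part of G by that of A, and
    of the SR1 update, where Cauchy-Schwarz for G - A applies.

    For the decay, with d = x_(k+1) - x_k, the new gradient g' satisfies
    g' = (g' - g) - G d since G d = - g.  It suffices to pair g' with the vector q
    such that H' q = g', where H' is the Hessian at x_(k+1), because then
    <g', q> = lambda_(k+1)^2 is also the squared norm of q for H'.  The mean value
    theorem gives <g', q> = <(J - H) d, q> + <(H - G) d, q> for the Hessian J at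
    some point of the segment, which may depend on q.  By strong self-concordance
    J - H lies between - s H and s H with s = M r_k; and in terms of p with
    H p = g the second term is the form H - H G^-1 H evaluated at (p, q), which
    lies between 0 and (1 - 1 / eta) H.  A symmetric form bounded by a multiple of H
    on the diagonal is bounded accordingly off the diagonal
    ([form_bound_posdef]), so that
    lambda_(k+1) <= (1 + s / 2) (s + 1 - 1 / eta) lambda_k
    ([local_grad_norm_quasi_newton_step]).  When the starting point is close
    enough this factor is at most 1 - mu / (2 L) ([contraction_factor_le]), and the
    resulting geometric series bounds the exponent in eta_k by ln (3 / 2).

    Several of these steps need symmetric Hessians.  As the Hessian is only
    assumed to exist as the derivative of the gradient, its symmetry is proved by
    comparing second differences of f ([hessian_sym]). *)

(** * Derivatives along lines in finite-dimensional spaces *)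

Section Calculus.
Context {R : realType} {V W : vectType R}.
Implicit Types (F : V -> W) (l : {linear W -> R^o}).

Lemma linear_form_continuous m (l : {linear 'rV[R]_m -> R^o}) : continuous l.
Proof.
have lE : (l : 'rV[R]_m -> R^o) =
    \sum_(i < m) ((fun v : 'rV[R]_m => v 0 i : R) * cst (l (delta_mx 0 i) : R)).
  apply/funext => v; rewrite {1}[v]row_sum_delta linear_sum fct_sumE.
  by apply: eq_bigr => i _; rewrite linearZ.
move=> v; apply: (@differentiable_continuous _ _ R^o); rewrite lE.
apply: differentiable_sum => i; apply: differentiableM.
  exact: differentiable_coord.
exact: differentiable_cst.
Qed.

(** Differentiability and differentials are defined through the coordinates v2r,
    so scalar functions l (F x) are first studied as functions of coordinates. *)
Definition coord_form F l : 'rV[R]_(dim V) -> R^o :=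
  (l \o r2v) \o in_coord F.

Lemma coord_form_diff F l (x : V) : vdifferentiable F x ->
  differentiable (coord_form F l) (v2r x) /\
  forall h : V, 'd (coord_form F l) (v2r x) (v2r h) = l (vdiff F x h).
Proof.
move=> dF; have lc := @linear_form_continuous _ (l \o r2v)%FUN.
have dl : differentiable (l \o r2v) (in_coord F (v2r x)).
  exact: linear_differentiable.
split; first exact: differentiable_comp.
move=> h; rewrite /coord_form diff_comp // /= vdiffE.
by rewrite (diff_lin _ lc).
Qed.

Lemma vdiff_along_line F l (x d : V) t : vdifferentiable F (x + t *: d) ->
  is_derive t 1 (fun s : R => l (F (x + s *: d)) : R^o) (l (vdiff F (x + t *: d) d)).
Proof.
move=> dF; have [dc dcE] := coord_form_diff l dF.
pose a (s : R) : 'rV[R]_(dim V) := v2r x + s *: v2r d.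
have aE s : a s = v2r (x + s *: d) by rewrite /a linearD linearZ.
have -> : (fun s : R => l (F (x + s *: d)) : R^o) = coord_form F l \o a.
  by apply/funext => s; rewrite /coord_form /in_coord /= aE !v2rK.
rewrite -aE in dc dcE.
have da : is_diff t a ( *:%R ^~ (v2r d)).
  rewrite -[X in is_diff _ _ X](add0r _).
  exact: is_diffD.
apply: DeriveDef.
  exact/diff_derivable/differentiable_comp.
rewrite deriveE; last exact: differentiable_comp.
rewrite diff_comp //=.
have -> : 'd a t = *:%R ^~ (v2r d) :> (R -> _) by exact: diff_val.
by rewrite scale1r dcE.
Qed.

(** The Frechet remainder restricted to the plane spanned by h and k.  It is
    uniform in both parameters, which directional derivatives alone do not give;
    the second difference of f depends on this. *)
Lemma vdiff_remainder F l (x h k : V) : vdifferentiable F x ->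
  forall eps : R, 0 < eps -> exists2 del : R, 0 < del &
  forall s t : R, `|s| < del -> `|t| < del ->
    `|l (F (x + (s *: h + t *: k))) - l (F x)
       - (s * l (vdiff F x h) + t * l (vdiff F x k))| <= eps * (`|s| + `|t|).
Proof.
move=> dF eps eps0; have [dc dcE] := coord_form_diff l dF.
(* The summand 1 makes C positive when h and k both vanish. *)
set C := `|v2r h| + `|v2r k| + 1.
have C0 : 0 < C by rewrite ltr_wpDl ?addr_ge0.
have /eqaddoP/(_ (eps / C)) := diff_locally dc.
rewrite divr_gt0 // => /(_ isT) /nbhs_ballP [r /= r0 rB].
exists (r / (C * 2)); first by rewrite divr_gt0 ?mulr_gt0.
move=> s t sd td.
set v := s *: v2r h + t *: v2r k.
have vle : `|v| <= C * (`|s| + `|t|).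
  rewrite (le_trans (ler_normD _ _)) // !normrZ mulrDr.
  rewrite lerD // mulrC ler_wpM2r // /C.
    by rewrite -addrA lerDl addr_ge0.
  by rewrite addrAC lerDr addr_ge0.
have vr : `|v| < r.
  rewrite (le_lt_trans vle) // -ltr_pdivlMl //.
  have -> : C^-1 * r = r / (C * 2) + r / (C * 2).
    by field; rewrite gt_eqF.
  exact: ltrD.
have := rB v; rewrite -ball_normE /= sub0r normrN => /(_ vr).
have -> : v = v2r (s *: h + t *: k) by rewrite linearD !linearZ.
rewrite /= !fctE /= dcE /coord_form /in_coord /= -linearD !v2rK.
rewrite [_ + x]addrC.
have -> : v2r (s *: h + t *: k) = v by rewrite linearD !linearZ.
rewrite !(linearD (vdiff F x)) !(linearZ_LR (vdiff F x)) (linearD l) !(linearZ_LR l).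
rewrite opprD addrA => /le_trans; apply.
by rewrite mulrAC ler_pdivrMr // -mulrA ler_pM2l // [_ * C]mulrC.
Qed.

End Calculus.

(** * Symmetry of the Hessian *)

Section SymmetricHessian.
Context {R : realType} {E : vectType R}.
Local Notation Es := 'Hom(E, R^o).
Implicit Types (f : E -> R) (x h k q : E).

Definition evaluation q (s : Es) : R^o := s q.

Fact evaluation_is_linear q : linear (evaluation q).
Proof. by move=> a s t; rewrite /evaluation !lfunE /= lfunE. Qed.

HB.instance Definition _ q :=
  GRing.isLinear.Build R Es R^o _ (evaluation q) (evaluation_is_linear q).

Lemma is_derive_along f x h (t : R) : twice_differentiable f ->
  is_derive t 1 (fun s : R => f (x + s *: h) : R^o) (gradient f (x + t *: h) h).
Proof.
by move=> [df _]; apply: (@vdiff_along_line _ _ _ (f : E -> R^o) idfun).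
Qed.

Lemma is_derive_gradient_along f x h q (t : R) : twice_differentiable f ->
  is_derive t 1 (fun s : R => gradient f (x + s *: h) q : R^o)
    (hessian f (x + t *: h) h q).
Proof.
by move=> [_ df]; apply: (@vdiff_along_line _ _ _ (gradient f) (evaluation q)).
Qed.

Lemma MVT_everywhere (g dg : R -> R) (a b : R) : a <= b ->
  (forall t : R, is_derive t 1 g (dg t)) ->
  exists2 c, c \in `[a, b]%R & g b - g a = dg c * (b - a).
Proof.
move=> ab gd; apply: MVT_segment => //.
apply: continuous_subspaceT => t.
by apply/differentiable_continuous/derivable1_diffP; have [] := gd t.
Qed.

Lemma second_difference_le (g0 g1 g2 a b c t eps : R) :
  0 < t -> c <= t -> 0 < eps ->
  `|g2 - g0 - (c * a + t * b)| <= eps * (c + t) ->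
  `|g1 - g0 - (c * a + 0 * b)| <= eps * (c + 0) ->
  `|(g2 - g1) * t - t ^+ 2 * b| <= 3 * eps * t ^+ 2.
Proof.
move=> t0 ct eps0; rewrite !ler_norml => /andP[H1 H2] /andP[H3 H4].
have -> : (g2 - g1) * t - t ^+ 2 * b = t * (g2 - g1 - t * b) by ring.
have -> : 3 * eps * t ^+ 2 = t * (3 * eps * t) by ring.
rewrite -mulrN !ler_pM2l //.
have : eps * c <= eps * t by rewrite ler_pM2l.
by move=> H5; apply/andP; split; lra.
Qed.

(** The mean value theorem in the direction h turns the second difference into an
    increment of the gradient between two points near x; the two remainders at
    these points cancel up to o(t^2).  Only the Hessian entry (k, h) survives,
    although the second difference is symmetric in h and k. *)
Lemma second_difference f x h k : twice_differentiable f ->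
  forall eps : R, 0 < eps -> exists2 del : R, 0 < del &
  forall t : R, 0 < t < del ->
    `|f (x + t *: k + t *: h) - f (x + t *: h) - (f (x + t *: k) - f x)
      - t ^+ 2 * hessian f x k h| <= 3 * eps * t ^+ 2.
Proof.
move=> tf eps eps0; have [_ dgf] := tf.
have [del del0 rem] := vdiff_remainder (evaluation h) h k (dgf x) eps0.
exists del => // t /andP[t0 td].
pose phi (s : R) := f (x + t *: k + s *: h) - f (x + s *: h).
have dphi (s : R) : is_derive s 1 phi
   (gradient f (x + t *: k + s *: h) h - gradient f (x + s *: h) h).
  have d1 := is_derive_along (x + t *: k) h s tf.
  have d2 := is_derive_along x h s tf.
  exact: (is_deriveB d1 d2).
have [c] := MVT_everywhere (ltW t0) dphi.
rewrite in_itv /= /phi !scale0r !addr0 subr0 => /andP[c0 ct] ->.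
have cd : `|c| < del by rewrite ger0_norm // (le_lt_trans ct).
have td' : `|t| < del by rewrite ger0_norm // ltW.
have := rem c t cd td'; have := rem c 0 cd; rewrite normr0 => /(_ del0).
rewrite scale0r addr0 /evaluation -/(hessian f x) addrA [x + _ + _]addrAC.
rewrite (ger0_norm c0) (gtr0_norm t0).
move=> rem0 remt; apply: second_difference_le remt rem0 => //.
Qed.

(** The second difference is symmetric in h and k, and t^2 times either entry
    approximates it up to o(t^2). *)
Lemma hessian_sym f x h k : twice_differentiable f ->
  hessian f x h k = hessian f x k h.
Proof.
move=> tf; apply/eqP; rewrite -subr_eq0 -normr_le0.
apply/ler_addgt0Pr => eps eps0; rewrite add0r.
(* Two second differences are compared, each with error 3 (eps / 6) t^2. *)
have e6 : 0 < eps / 6 by rewrite divr_gt0.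
have [d1 d10 H1] := second_difference x h k tf e6.
have [d2 d20 H2] := second_difference x k h tf e6.
pose t := Num.min d1 d2 / 2.
have m0 : 0 < Num.min d1 d2 by rewrite lt_min d10.
have t0 : 0 < t by rewrite divr_gt0.
have tm : t < Num.min d1 d2 by rewrite /t ltr_pdivrMr // ltr_pMr // ltr1n.
move: (tm); rewrite lt_min => /andP[td1 td2].
have := H1 t; rewrite t0 td1 => /(_ isT); have := H2 t; rewrite t0 td2 => /(_ isT).
rewrite [x + t *: h + t *: k]addrAC.
rewrite !ler_norml => /andP[G1 G2] /andP[G3 G4].
have t20 : 0 < t ^+ 2 by rewrite exprn_gt0.
rewrite -(ler_pM2l t20) -[X in _ && X](ler_pM2l t20).
by apply/andP; split; lra.
Qed.

End SymmetricHessian.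

(** * Self-adjoint operators as quadratic forms *)

Section Forms.
Context {R : realType} {E : vectType R}.
Local Notation Es := 'Hom(E, R^o).
Implicit Types (A G H S : 'Hom(E, Es)) (u v w h k p q d : E) (s g : Es) (c eta : R).

Definition self_adjoint A : Prop := forall h k, A h k = A k h.

Lemma loewnerP A G : loewner_le A G <-> forall h, A h h <= G h h.
Proof.
rewrite /loewner_le /pairing; split => AG h; have := AG h;
  by rewrite !(add_lfunE, opp_lfunE) subr_ge0.
Qed.

Lemma formD A h k q : A (h + k) q = A h q + A k q.
Proof. by rewrite linearD add_lfunE. Qed.

Lemma formN A h q : A (- h) q = - A h q.
Proof. by rewrite linearN opp_lfunE. Qed.

Lemma formB A h k q : A (h - k) q = A h q - A k q.
Proof. by rewrite formD formN. Qed.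

Lemma formZ A c h q : A (c *: h) q = c * A h q.
Proof. by rewrite linearZ scale_lfunE. Qed.

Lemma formDr A h q k : A h (q + k) = A h q + A h k.
Proof. by rewrite linearD. Qed.

Lemma formNr A h q : A h (- q) = - A h q.
Proof. by rewrite linearN. Qed.

Lemma formBr A h q k : A h (q - k) = A h q - A h k.
Proof. by rewrite formDr formNr. Qed.

Lemma formZr A c h q : A h (c *: q) = c * A h q.
Proof. by rewrite linearZ. Qed.

Definition form_lin :=
  (formB, formD, formN, formZ, formBr, formDr, formNr, formZr).

Lemma opformD A G h q : (A + G) h q = A h q + G h q.
Proof. by rewrite !add_lfunE. Qed.

Lemma opformN A h q : (- A) h q = - A h q.
Proof. by rewrite !opp_lfunE. Qed.

Lemma opformB A G h q : (A - G) h q = A h q - G h q.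
Proof. by rewrite opformD opformN. Qed.

Lemma opformZ A c h q : (c *: A) h q = c * A h q.
Proof. by rewrite !scale_lfunE. Qed.

(** Polarization: for w and q scaled to equal A-norms, four times S w q is the
    difference of the values of S at w + q and w - q, and the parallelogram
    identity evaluates the sum of those of A.  The case S = A is Cauchy-Schwarz. *)
Lemma form_bound_posdef S A c : posdef A -> self_adjoint S ->
  (forall w, `|S w w| <= c * A w w) ->
  forall w q, `|S w q| <= c * Num.sqrt (A w w) * Num.sqrt (A q q).
Proof.
move=> Apos Ssym SA w q.
have [->|w0] := eqVneq w 0.
  by rewrite !(linear0, zero_lfunE) normr0 sqrtr0 mulr0 mul0r.
have [->|q0] := eqVneq q 0; first by rewrite !linear0 normr0 sqrtr0 mulr0.
have a0 : 0 < Num.sqrt (A w w) by rewrite sqrtr_gt0; exact: Apos.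
have b0 : 0 < Num.sqrt (A q q) by rewrite sqrtr_gt0; exact: Apos.
have aE : A w w = Num.sqrt (A w w) ^+ 2 by rewrite sqr_sqrtr // ltW //; exact: Apos.
have bE : A q q = Num.sqrt (A q q) ^+ 2 by rewrite sqr_sqrtr // ltW //; exact: Apos.
move: (Num.sqrt (A w w)) (Num.sqrt (A q q)) a0 b0 aE bE => a b a0 b0 aE bE.
have := SA (b *: w + a *: q); have := SA (b *: w - a *: q).
rewrite !form_lin (Ssym q w) aE bE => H1 H2.
rewrite -(ler_pM2l (mulr_gt0 a0 b0)) -[X in X * `|_|]gtr0_norm ?mulr_gt0 // -normrM.
move: H1 H2; rewrite !ler_norml => /andP[H1 H2] /andP[H3 H4].
by apply/andP; split; lra.
Qed.

(** Nonnegativity at the A-orthogonal projection of h off the line of u.  The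
    form is only semidefinite here, as is needed for differences G - A. *)
Lemma form_cauchy_schwarz A u h : self_adjoint A -> (forall k, 0 <= A k k) ->
  0 < A u u -> (A u u)^-1 * (A u h * A u h) <= A h h.
Proof.
move=> Asym Age0 u0.
have := Age0 (h - (A u h / A u u) *: u).
rewrite !form_lin (Asym h u).
set a := A u u in u0 *; set b := A u h; set c' := A h h.
move=> Akk; rewrite -subr_ge0; apply: le_trans Akk _.
by rewrite le_eqVlt; apply/orP; left; apply/eqP; field; rewrite gt_eqF.
Qed.

Lemma dim_dual : \dim {:Es} = \dim {:E}.
Proof. by rewrite !dimvf /dim /= muln1. Qed.

Lemma posdef_ge0 A h : posdef A -> 0 <= A h h.
Proof. by move=> Apos; have [->|/Apos/ltW//] := eqVneq h 0; rewrite linear0. Qed.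

Lemma lker0_invK (U V : vectType R) (F : 'Hom(U, V)) :
  lker F == 0%VS -> \dim {:U} = \dim {:V} -> cancel (F^-1)%VF F.
Proof.
move=> kF dimUV x; apply: limg_lfunVK.
have /eqP -> : limg F == fullv; last exact: memvf.
by rewrite eqEdim subvf limg_dim_eq ?dimUV ?leqnn // (eqP kF) capv0.
Qed.

Lemma posdef_invK A : posdef A -> cancel (A^-1)%VF A.
Proof.
move=> Apos; apply: lker0_invK; last by rewrite dim_dual.
rewrite -subv0; apply/subvP => h; rewrite memv_ker memv0 => /eqP Ah.
have [//|/Apos] := eqVneq h 0.
by rewrite Ah /pairing zero_lfunE ltxx.
Qed.

(** The sum D of the dyads is symmetric and, since s (D s) is the sum of the squares
    of the values of s on the basis, injective; hence D has a genuine inverse, which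
    inherits the symmetry. *)
Lemma basis_op_self_adjoint n (e : n.-tuple E) : basis_of fullv e ->
  self_adjoint (basis_op e).
Proof.
move=> eb; set D := \sum_(i < n) dyad (tnth e i).
have DE s t : s (D t) = \sum_(i < n) t (tnth e i) * s (tnth e i) :> R.
  rewrite sum_lfunE linear_sum; apply: eq_bigr => i _.
  by rewrite dyadE linearZ.
have kD : lker D == 0%VS.
  rewrite -subv0; apply/subvP => s; rewrite memv_ker memv0 => /eqP Ds.
  have := DE s s; rewrite Ds linear0 => /esym/eqP.
  rewrite psumr_eq0 => [/allP H|i _]; last by rewrite -expr2 sqr_ge0.
  apply/eqP/lfunP => h; rewrite zero_lfunE.
  have := memvf h; rewrite -(span_basis eb) => /coord_span ->.
  rewrite linear_sum big1 // => i _; rewrite linearZ /=.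
  have := H i (mem_index_enum _); rewrite mulf_eq0 orbb (tnth_nth 0) => /eqP ->.
  by rewrite scaler0.
have DK : cancel (D^-1)%VF D by apply: lker0_invK; rewrite ?dim_dual.
move=> h k; rewrite /basis_op -/D -{1}(DK k) -{2}(DK h) !DE.
by apply: eq_bigr => i _; rewrite mulrC.
Qed.

(** * The Broyden update *)

Lemma dyad_formE A G u h k : (A \o dyad u \o G)%VF h k = G h u * A u k.
Proof. by rewrite !comp_lfunE dyadE formZ. Qed.

Lemma Broyd_formE tau G A u h k : G u != A u ->
  Broyd tau G A u h k =
    tau * (G h k - (A u u)^-1 * (G h u * A u k + A h u * G u k)
             + (G u u / A u u + 1) / A u u * (A h u * A u k))
    + (1 - tau) * (G h k - ((G - A) u u)^-1 * ((G - A) h u * (G - A) u k)).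
Proof.
move=> /negPf Gu; rewrite /Broyd Gu.
rewrite (opformD (tau *: _)) (opformZ _ tau) (opformZ _ (1 - tau)).
rewrite (opformD (G - _ *: (_ + _))) (opformB G (_ *: (_ + _))).
rewrite (opformB G (_ *: (_ \o _ \o _)%VF)) !(opformZ _ _ h k).
by rewrite (opformD (_ \o _)%VF) !dyad_formE.
Qed.

Lemma Broyd_self_adjoint tau G A u : self_adjoint G -> self_adjoint A ->
  self_adjoint (Broyd tau G A u).
Proof.
move=> Gsym Asym h k; have [Gu|Gu] := eqVneq (G u) (A u).
  by rewrite /Broyd Gu eqxx.
rewrite !Broyd_formE // !opformB (Gsym k h) (Gsym u k) (Gsym u h) (Asym u k) (Asym u h).
by ring.
Qed.

(** Both extreme members of the family respect the bounds.  For DFP, with w the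
    A-orthogonal projection of h off the line of u, the updated form at h is
    G w w + (A u h)^2 / A u u, while A h h is A w w plus the same square.  For SR1,
    the subtracted term is nonnegative, and Cauchy-Schwarz for G - A bounds it by
    (G - A) h h. *)
Lemma Broyd_loewner tau G A u eta :
  posdef A -> self_adjoint G -> self_adjoint A -> 0 <= tau <= 1 ->
  loewner_le A G -> loewner_le G (eta *: A) ->
  loewner_le A (Broyd tau G A u) /\ loewner_le (Broyd tau G A u) (eta *: A).
Proof.
move=> Apos Gsym Asym /andP[tau0 tau1] AG GA.
have [Gu|Gu] := eqVneq (G u) (A u); first by rewrite /Broyd Gu eqxx.
have u0 : u != 0 by apply: contra Gu => /eqP ->; rewrite !linear0.
have a0 : 0 < A u u by exact: Apos.
have {}AG h : A h h <= G h h by apply/loewnerP: h.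
have {}GA h : G h h <= eta * A h h by rewrite -opformZ; apply/loewnerP: h.
(* This uses the bounds at u itself, where A does not vanish. *)
have eta1 : 1 <= eta.
  by rewrite -(ler_pM2r a0) mul1r (le_trans (AG u)).
have DFP h : A h h <= G h h - (A u u)^-1 * (G h u * A u h + A h u * G u h)
             + (G u u / A u u + 1) / A u u * (A h u * A u h) <= eta * A h h.
  pose w := h - (A u h / A u u) *: u.
  have gE : G h h - (A u u)^-1 * (G h u * A u h + A h u * G u h)
             + (G u u / A u u + 1) / A u u * (A h u * A u h)
      = G w w + (A u h) ^+ 2 / A u u.
    rewrite /w !form_lin (Asym h u) (Gsym h u).
    move: (G h h) (G u h) (G u u) (A u h) (A u u) a0 => c1 c2 c3 c4 c5 c5_gt0.
    by field; rewrite gt_eqF.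
  have aE : A h h = A w w + (A u h) ^+ 2 / A u u.
    rewrite /w !form_lin (Asym h u).
    move: (A h h) (A u h) (A u u) a0 => c1 c2 c3 c3_gt0.
    by field; rewrite gt_eqF.
  rewrite gE aE lerD2r AG /= mulrDr lerD //.
  by rewrite ler_peMl // divr_ge0 ?sqr_ge0 // ltW.
have D0 k : 0 <= (G - A) k k by rewrite opformB subr_ge0.
have Dsym : self_adjoint (G - A) by move=> h k; rewrite !opformB Gsym Asym.
have SR1 h : A h h <= G h h - ((G - A) u u)^-1 * ((G - A) h u * (G - A) u h)
    <= eta * A h h.
  rewrite (Dsym h u); apply/andP; split; last first.
    rewrite (le_trans _ (GA h)) // gerBl mulr_ge0 ?invr_ge0 //.
    by rewrite -expr2 sqr_ge0.
  rewrite lerBrDl addrC -lerBrDl -opformB.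
  (* G - A may vanish at u; the inverse of 0 being 0, the correction is then 0. *)
  have := D0 u; rewrite le_eqVlt => /orP[/eqP <-|Du]; first by rewrite invr0 mul0r.
  exact: form_cauchy_schwarz.
have mix (a b c1 c2 : R) : a <= c1 <= b -> a <= c2 <= b ->
    a <= tau * c1 + (1 - tau) * c2 <= b.
  by move=> /andP[? ?] /andP[? ?]; apply/andP; split; nra.
by split; apply/loewnerP => h; rewrite ?opformZ Broyd_formE //;
  have /andP[] := mix _ _ _ _ (DFP h) (SR1 h).
Qed.

(** * One quasi-Newton step *)

(** Here - H p plays the role of minus the gradient, so d is the step.  The form
    H - H G^-1 H lies between 0 and (1 - 1 / eta) H, and its value at (p, q) is
    (H d - G d) q, since G^-1 (H p) = - d. *)
Lemma quasi_newton_step_bounds H G eta p d :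
  posdef H -> self_adjoint H -> self_adjoint G ->
  loewner_le H G -> loewner_le G (eta *: H) -> 0 < eta -> G d = - H p ->
  H d d <= H p p /\
  forall q, `|(H d - G d) q| <= (1 - eta^-1) * Num.sqrt (H p p) * Num.sqrt (H q q).
Proof.
move=> Hpos Hsym Gsym HG GH eta0 Gd.
have {}HG h : H h h <= G h h by apply/loewnerP: h.
have {}GH h : G h h <= eta * H h h by rewrite -opformZ; apply/loewnerP: h.
have Gpos : posdef G by move=> h /Hpos; move/lt_le_trans; apply; exact: HG.
have GK := posdef_invK Gpos.
(* Both bounds on the form H G^-1 H come from completing squares: at w - v for H,
   and at v - w / eta for G. *)
have HGH w : let v := (G^-1)%VF (H w) in
  [/\ H v v <= H w v, eta^-1 * H w w <= H w v & H w v <= H w w].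
  move=> v; have Gv q : G v q = H w q by rewrite GK.
  have Hvv : H v v <= H w v by rewrite -Gv.
  have Hge0 h : 0 <= H h h by exact: posdef_ge0.
  split=> //.
    have : 0 <= G (v - eta^-1 *: w) (v - eta^-1 *: w).
      exact: le_trans (Hge0 _) (HG _).
    rewrite !form_lin (Gsym w v) !Gv => H1.
    have : eta^-1 * G w w <= H w w by rewrite ler_pdivrMl.
    have : 0 < eta^-1 by rewrite invr_gt0.
    by move=> e0 H2; nra.
  have := Hge0 (w - v).
  by rewrite !form_lin (Hsym v w) => H1; lra.
have dE : (G^-1)%VF (H p) = - d.
  apply/eqP; rewrite -subr_eq0; apply/eqP; set z := _ - _.
  have [//|/Gpos] := eqVneq z 0.
  rewrite (_ : G z = 0) /pairing ?zero_lfunE ?ltxx //.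
  by rewrite /z linearB /= GK linearN /= Gd opprK subrr.
split.
  have [] := HGH p; rewrite /= dE !form_lin opprK => H1 _ H2.
  exact: le_trans H2.
pose S := H - (H \o G^-1 \o H)%VF.
have SE w : S w = H w - H ((G^-1)%VF (H w)).
  by rewrite /S !(add_lfunE, opp_lfunE, comp_lfunE).
have Ssym : self_adjoint S.
  move=> w1 w2; rewrite !SE !(add_lfunE, opp_lfunE) (Hsym w1 w2); congr (_ - _).
  have Gv w q : G ((G^-1)%VF (H w)) q = H w q by rewrite GK.
  by rewrite (Hsym _ w2) (Hsym _ w1) -(Gv w2) -(Gv w1) Gsym.
have SH w : `|S w w| <= (1 - eta^-1) * H w w.
  have [_ H1 H2] := HGH w; rewrite SE add_lfunE opp_lfunE.
  rewrite (Hsym ((G^-1)%VF (H w)) w) ger0_norm ?subr_ge0 //.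
  by rewrite mulrBl mul1r lerD2l lerN2.
move=> q; have := form_bound_posdef Hpos Ssym SH p q.
by rewrite SE dE Gd linearN !opprK addrC.
Qed.

End Forms.

Lemma increment_split (R : comPzRingType) (g0 g1 j h e : R) :
  g1 - g0 = j -> e = - g0 -> g1 = (j - h) + (h - e).
Proof. by move=> <- ->; ring. Qed.

Lemma sqrt_le_half (R : realType) (a b s : R) : 0 <= s -> 0 <= b ->
  a <= (1 + s) * b -> Num.sqrt a <= (1 + s / 2) * Num.sqrt b.
Proof.
move=> s0 b0 ab; have s20 : 0 <= 1 + s / 2 by rewrite addr_ge0 // divr_ge0.
rewrite -(ger0_norm s20) -sqrtr_sqr -sqrtrM ?sqr_ge0 // ler_sqrt; last first.
  by rewrite mulr_ge0 ?sqr_ge0.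
rewrite (le_trans ab) // ler_wpM2r //.
by have := sqr_ge0 s; nra.
Qed.

(** The real arithmetic of [local_grad_norm_quasi_newton_step]: lam and lam1 stand
    for the gradient norms before and after the step, nq for the norm, at the old
    point, of the Newton direction at the new one. *)
Lemma contraction_of_bounds (R : realType) (lam lam1 r s c nq a b : R) :
  0 <= lam -> 0 <= lam1 -> 0 <= s -> 0 <= c -> 0 <= nq ->
  lam1 ^+ 2 = a + b -> `|a| <= s * r * nq -> r <= lam -> `|b| <= c * lam * nq ->
  nq <= (1 + s / 2) * lam1 ->
  lam1 <= (1 + s / 2) * (s + c) * lam.
Proof.
move=> lam0 lam10 s0 c0 nq0 lam1sq a_le r_le b_le nq_le.
have sr : s * r * nq <= s * lam * nq by rewrite ler_wpM2r // ler_wpM2l.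
have key : lam1 ^+ 2 <= (s + c) * lam * nq.
  have := ler_norm a; have := ler_norm b; lra.
have C0 : 0 <= (s + c) * lam by rewrite mulr_ge0 // addr_ge0.
have key2 : lam1 * lam1 <= (1 + s / 2) * (s + c) * lam * lam1.
  by have := ler_wpM2l C0 nq_le; lra.
have [l0|l0] := ltrP 0 lam1; first by rewrite ler_pM2r in key2.
by rewrite (le_trans l0) // -mulrA mulr_ge0 // addr_ge0 // divr_ge0.
Qed.

Section Step.
Context {R : realType} {E : vectType R}.
Local Notation Es := 'Hom(E, R^o).
Variables (f : E -> R) (M : R).
Hypotheses (f_diff2 : twice_differentiable f)
  (f_posdef : forall x : E, posdef (hessian f x))
  (M_ge0 : 0 <= M) (f_ssc : strongly_self_concordant f M).
Implicit Types (x y z w h p q d : E) (s : R) (G : 'Hom(E, Es)).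

Let H_ge0 x h : 0 <= hessian f x h h.
Proof. exact: posdef_ge0. Qed.

Lemma hessian_onto x (g : Es) : exists p, hessian f x p = g.
Proof. by exists ((hessian f x)^-1%VF g); apply: (posdef_invK (f_posdef x)). Qed.

Lemma local_normZ x c h : local_norm f x (c *: h) = `|c| * local_norm f x h.
Proof.
rewrite /local_norm /pairing !form_lin mulrA -expr2 sqrtrM ?sqr_ge0 //.
by rewrite sqrtr_sqr.
Qed.

Lemma local_normN x h : local_norm f x (- h) = local_norm f x h.
Proof. by rewrite -scaleN1r local_normZ normrN1 mul1r. Qed.

Lemma hessian_lipschitz x y z w h :
  hessian f y h h - hessian f x h h
    <= M * local_norm f z (y - x) * hessian f w h h.
Proof. by rewrite -opformB -opformZ; apply/loewnerP: h; exact: f_ssc. Qed.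

Lemma hessian_le_next x y h :
  hessian f x h h <= (1 + M * local_norm f x (y - x)) * hessian f y h h.
Proof.
have := hessian_lipschitz y x x y h.
by rewrite -[x - y]opprB local_normN mulrDl mul1r -lerBlDl.
Qed.

Lemma hessian_next_le x y h :
  hessian f y h h <= (1 + M * local_norm f x (y - x)) * hessian f x h h.
Proof. by rewrite mulrDl mul1r -lerBlDl; exact: hessian_lipschitz. Qed.

(** Strong self-concordance allows the right-hand Hessian to be taken at x in both
    directions, which gives a two-sided bound without any loss. *)
Lemma hessian_segment x d c w : 0 <= c <= 1 ->
  `|(hessian f (x + c *: d) - hessian f x) w w|
    <= M * local_norm f x d * hessian f x w w.
Proof.
move=> /andP[c0 c1]; set y := x + c *: d.
have nd : M * local_norm f x (c *: d) * hessian f x w w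
    <= M * local_norm f x d * hessian f x w w.
  rewrite local_normZ (ger0_norm c0) ler_wpM2r ?H_ge0 // ler_wpM2l //.
  by rewrite ler_piMl // sqrtr_ge0.
have yx : y - x = c *: d by rewrite /y addrAC subrr add0r.
have xy : x - y = - (c *: d) by rewrite -yx opprB.
have A1 := hessian_lipschitz x y x x w; rewrite yx in A1.
have A2 := hessian_lipschitz y x x x w; rewrite xy local_normN in A2.
rewrite opformB ler_distlC lerBlDr; apply/andP; split.
  by rewrite -lerBlDl; exact: le_trans A1 nd.
by rewrite -lerBlDl; exact: le_trans A2 nd.
Qed.

Lemma local_grad_normE x p : hessian f x p = gradient f x ->
  local_grad_norm f x = Num.sqrt (hessian f x p p).
Proof.
move=> Hp; rewrite /local_grad_norm /pairing -[in LHS]Hp hessian_sym //.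
by rewrite posdef_invK ?Hp.
Qed.

(** Since G dominates the Hessian, the quasi-Newton step is no longer than the
    Newton step. *)
Lemma local_norm_quasi_newton_step x G eta d :
  self_adjoint G -> loewner_le (hessian f x) G ->
  loewner_le G (eta *: hessian f x) -> 0 < eta -> G d = - gradient f x ->
  local_norm f x d <= local_grad_norm f x.
Proof.
move=> Gsym HG GH eta0 Gd; have [p Hp] := hessian_onto x (gradient f x).
rewrite (local_grad_normE Hp); rewrite -Hp in Gd.
have Hsym : self_adjoint (hessian f x).
  by move=> h k; exact: (hessian_sym _ _ _ f_diff2).
have [Hd _] := quasi_newton_step_bounds (f_posdef x) Hsym Gsym HG GH eta0 Gd.
by rewrite /local_norm ler_sqrt ?H_ge0.
Qed.

(** The new gradient is tested only against its own Newton direction q, so the mean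
    value theorem may be applied to this single component of the gradient. *)
Lemma local_grad_norm_quasi_newton_step x G eta d s :
  self_adjoint G -> loewner_le (hessian f x) G ->
  loewner_le G (eta *: hessian f x) -> 1 <= eta -> G d = - gradient f x ->
  s = M * local_norm f x d ->
  local_grad_norm f (x + d)
    <= (1 + s / 2) * (s + (1 - eta^-1)) * local_grad_norm f x.
Proof.
move=> Gsym HG GH eta1 Gd sE; have eta0 : 0 < eta := lt_le_trans ltr01 eta1.
have rl := local_norm_quasi_newton_step Gsym HG GH eta0 Gd.
have [p Hp] := hessian_onto x (gradient f x).
have [q H1q] := hessian_onto (x + d) (gradient f (x + d)).
set H := hessian f x in Hp *; set H1 := hessian f (x + d) in H1q *.
have Hsym : self_adjoint (hessian f x).
  by move=> h k; exact: (hessian_sym _ _ _ f_diff2).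
have lamE := local_grad_normE Hp; have lam1E := local_grad_normE H1q.
rewrite -Hp in Gd.
have [_ /(_ q)] := quasi_newton_step_bounds (f_posdef x) Hsym Gsym HG GH eta0 Gd.
rewrite -lamE => HGq.
set lam := local_grad_norm f x in rl lamE HGq *.
set lam1 := local_grad_norm f (x + d) in lam1E *.
have lam0 : 0 <= lam by exact: sqrtr_ge0.
have lam10 : 0 <= lam1 by exact: sqrtr_ge0.
have r0 : 0 <= local_norm f x d by exact: sqrtr_ge0.
have s0 : 0 <= s by rewrite sE mulr_ge0.
have [c] := MVT_everywhere ler01 (fun t => is_derive_gradient_along x d q t f_diff2).
rewrite in_itv /= scale1r scale0r addr0 subr0 mulr1 => /andP[c0 c1] gradE.
set J := hessian f (x + c *: d) in gradE.
have Jsym : self_adjoint (J - H).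
  by move=> h k; rewrite !opformB /J /H; congr (_ - _);
    exact: (hessian_sym _ _ _ f_diff2).
have JH w : `|(J - H) w w| <= s * H w w.
  by rewrite sE; apply: hessian_segment; rewrite ?c0.
have JHq := form_bound_posdef (f_posdef x) Jsym JH d q.
have nq : Num.sqrt (hessian f x q q) <= (1 + s / 2) * lam1.
  rewrite lam1E; apply: sqrt_le_half; rewrite ?H_ge0 //.
  have := hessian_le_next x (x + d) q.
  by rewrite (_ : x + d - x = d) ?sE // addrAC subrr add0r.
have lam1sq : lam1 ^+ 2 = (J - H) d q + (H d - G d) q.
  have GdE : G d q = - gradient f x q by rewrite Gd opp_lfunE Hp.
  have lam1g : lam1 ^+ 2 = gradient f (x + d) q.
    rewrite lam1E sqr_sqrtr; last exact: H_ge0.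
    by rewrite /H1 in H1q; rewrite H1q.
  have HGE : (H d - G d) q = H d q - G d q by rewrite add_lfunE opp_lfunE.
  by rewrite lam1g (opformB J) HGE; exact: increment_split gradE GdE.
have eta_inv : 0 <= 1 - eta^-1 by rewrite subr_ge0 invf_le1.
by apply: contraction_of_bounds lam1sq JHq rl HGq nq; rewrite ?sqrtr_ge0.
Qed.

End Step.

(** * Numerical estimates and convergence *)

(** The bound 3 / 7 is four times 3 / 28, and (1 + 3 / 28)^4 just exceeds 3 / 2. *)
Lemma ln_3_2_le (R : realType) : ln (3 / 2 : R) <= 3 / 7.
Proof.
rewrite -ler_expR lnK ?posrE ?divr_gt0 //.
have -> : 3 / 7 = 4%:R * (3 / 28) :> R by field.
have e_ge := @expR_ge1Dx R (3 / 28).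
rewrite expRM_natl; apply: (@le_trans _ _ ((1 + 3 / 28) ^+ 4)); first by lra.
by apply: lerXn2r => //; rewrite nnegrE ?expR_ge0 // addr_ge0 // divr_ge0.
Qed.

(** To be read with m = mu / L, s = M r_k and e = 1 / eta_k.  The hypotheses on s and e
    hold because ln (3 / 2) / 4 <= 3 / 28 and eta_k <= 3 / (2 m), and the margin is
    small: 47 / 84 = 2 / 3 - 3 / 28, and 47 / 84 - 3 / 56 = 85 / 168, which is
    slightly more than 1 / 2. *)
Lemma contraction_factor_le (R : realType) (m s e : R) :
  0 <= m -> 0 <= s <= 3 / 28 * m -> 2 / 3 * m <= e <= 1 ->
  (1 + s / 2) * (s + (1 - e)) <= 1 - m / 2.
Proof.
move=> m0 /andP[s0 s1] /andP[e0 e1].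
have sum_ge0 : 0 <= s + (1 - e) by lra.
apply: (@le_trans _ _ ((1 + 3 / 56 * m) * (s + (1 - e)))).
  by apply: ler_wpM2r => //; lra.
apply: (@le_trans _ _ ((1 + 3 / 56 * m) * (1 - 47 / 84 * m))).
  by apply: ler_wpM2l; lra.
have := mulr_ge0 m0 m0; lra.
Qed.

Lemma scaled_chain (R : realType) (g h h' s a b : R) :
  0 <= a -> 0 <= s -> 0 <= h' -> g <= a * h -> h <= (1 + s) * h' ->
  (1 + s) ^+ 2 * a <= b -> (1 + s) * g <= b * h'.
Proof.
move=> a0 s0 h0 gh hh ab; have s1 : 0 <= 1 + s by rewrite addr_ge0.
apply: le_trans (ler_wpM2l s1 gh) _.
apply: le_trans (ler_wpM2l s1 (ler_wpM2l a0 hh)) _.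
by have := ler_wpM2r h0 ab; lra.
Qed.

Theorem theorem4p7 (R : realType) (n : nat) (E : vectType R) (e : n.-tuple E)
    (e_basis : basis_of fullv e)
    (f : E -> R) (M mu L : R)
    (f_diff2 : twice_differentiable f)
    (f_posdef : forall x : E, posdef (hessian f x))
    (M_ge0 : 0 <= M)
    (f_ssc : strongly_self_concordant f M)
    (mu_gt0 : 0 < mu) (L_gt0 : 0 < L)
    (f_bounds : forall x : E,
       loewner_le (mu *: basis_op e) (hessian f x) /\
       loewner_le (hessian f x) (L *: basis_op e))
    (x : nat -> E) (G : nat -> 'Hom(E, 'Hom(E, R^o)))
    (u : nat -> E) (tau : nat -> R)
    (scheme : quasi_newton_scheme e f M L x G u tau)
    (x0_close : M * local_grad_norm f (x 0%N) <= ln (3 / 2) / 4 * (mu / L))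
    (k : nat) :
  [/\ loewner_le (hessian f (x k)) (G k),
      loewner_le (G k)
        ((expR (2 * M * \sum_(i < k) local_grad_norm f (x i)) * (L / mu))
           *: hessian f (x k)),
      loewner_le
        ((expR (2 * M * \sum_(i < k) local_grad_norm f (x i)) * (L / mu))
           *: hessian f (x k))
        ((3 * L / (2 * mu)) *: hessian f (x k))
    & local_grad_norm f (x k)
        <= (1 - mu / (2 * L)) ^+ k * local_grad_norm f (x 0%N)].

Proof.
have [f_H0 step] := scheme.
(* A nonzero vector is what forces mu <= L; over the zero space mu and L are
   unrelated, but all the quantities compared vanish. *)
have [[h0 hn0]|Etriv] := pselect (exists h : E, h != 0); last first.
  have E0 (h : E) : h = 0.
    by apply/eqP/negPn/negP => hn0; apply: Etriv; exists h.
  have lo A1 A2 : @loewner_le R E A1 A2.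
    by move=> h; rewrite (E0 h) /pairing linear0.
  have lam0 y : local_grad_norm f y = 0.
    rewrite /local_grad_norm [X in pairing _ X]E0 /pairing linear0.
    exact: sqrtr0.
  by split; [exact: lo | exact: lo | exact: lo | rewrite !lam0 mulr0].
set m := mu / L.
have m_gt0 : 0 < m by rewrite divr_gt0.
have muL : mu <= L.
  have [/loewnerP/(_ h0) B1 /loewnerP/(_ h0) B2] := f_bounds (x 0%N).
  have Hpos := f_posdef (x 0%N) h0 hn0; rewrite /pairing in Hpos.
  rewrite !opformZ in B1 B2.
  have B0 : 0 < basis_op e h0 h0.
    by rewrite -(pmulr_rgt0 _ L_gt0); exact: lt_le_trans B2.
  by rewrite -(ler_pM2r B0); exact: le_trans B2.
have m_le1 : m <= 1 by rewrite ler_pdivrMr // mul1r.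
have [lam lamE] : exists lam : nat -> R, forall i, local_grad_norm f (x i) = lam i.
  by exists (fun i => local_grad_norm f (x i)).
have lam_ge0 i : 0 <= lam i by rewrite -lamE; exact: sqrtr_ge0.
under eq_bigr do rewrite lamE.
rewrite !lamE; rewrite lamE -/m in x0_close.
pose S j := \sum_(i < j) lam i.
pose eta j := expR (2 * M * S j) * (L / mu).
pose rho := 1 - m / 2.
have rho_ge0 : 0 <= rho by rewrite /rho; lra.
have rho_le1 : rho <= 1 by rewrite /rho; lra.
have rhoE : 1 - mu / (2 * L) = rho.
  by rewrite /rho /m; field; rewrite gt_eqF.
have mV : L / mu = m^-1 by rewrite invf_div.
(* The hypothesis is the summed form of the geometric decay, with ratio
   rho = 1 - m / 2; it bounds the exponent in eta j by ln (3 / 2). *)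
have eta_le j : m / 2 * S j <= lam 0%N * (1 - rho ^+ j) ->
    1 <= eta j <= 3 / 2 * m^-1.
  move=> Sj; have S0 : 0 <= S j by exact: sumr_ge0.
  have rj : 0 <= rho ^+ j by rewrite exprn_ge0.
  have MS : 2 * M * S j <= ln (3 / 2).
    have H1 : M * (m / 2 * S j) <= M * lam 0%N.
      rewrite ler_wpM2l // (le_trans Sj) // ler_piMr //; lra.
    rewrite -(ler_pM2l m_gt0); lra.
  rewrite /eta mV; apply/andP; split.
    rewrite -[1]mulr1 ler_pM // ?invf_ge1 //.
    by rewrite -expR0 ler_expR !mulr_ge0.
  rewrite ler_wpM2r ?invr_ge0 ?(ltW m_gt0) //.
  by rewrite -[leRHS]lnK ?posrE ?divr_gt0 // ler_expR.
have inv j : [/\ self_adjoint (G j), loewner_le (hessian f (x j)) (G j),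
    loewner_le (G j) (eta j *: hessian f (x j)),
    lam j <= rho ^+ j * lam 0%N & m / 2 * S j <= lam 0%N * (1 - rho ^+ j)].
  elim: j => [|j [Gsym HG GH lamj Sj]].
    have [B1 B2] := f_bounds (x 0%N).
    rewrite f_H0; split.
    - by move=> h q; rewrite !opformZ (basis_op_self_adjoint e_basis).
    - exact: B2.
    - apply/loewnerP => h; rewrite /eta /S big_ord0 mulr0 expR0 mul1r.
      move/loewnerP: B1 => /(_ h); rewrite !opformZ mulrAC ler_pdivlMr //.
      by rewrite -[_ * _ * mu]mulrA ler_pM2l // [_ * mu]mulrC.
    - by rewrite expr0 mul1r.
    - by rewrite /S big_ord0 expr0 subrr !mulr0.
  have /andP[eta1 eta32] := eta_le j Sj.
  have eta0 : 0 < eta j by exact: lt_le_trans eta1.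
  have [xE tau01 GE] := step j.
  set d := - (G j)^-1%VF (gradient f (x j)) in xE.
  have xd : x j.+1 - x j = d by rewrite xE addrAC subrr add0r.
  have Gpos : posdef (G j).
    move=> h /(f_posdef (x j)) /lt_le_trans; apply.
    by move/loewnerP: HG; apply.
  have Gd : G j d = - gradient f (x j) by rewrite /d linearN /= posdef_invK.
  set s := M * local_norm f (x j) d.
  have rl : local_norm f (x j) d <= lam j.
    rewrite -lamE; exact: (local_norm_quasi_newton_step f_diff2 f_posdef Gsym HG GH).
  have s_ge0 : 0 <= s by rewrite mulr_ge0 // sqrtr_ge0.
  have rj : rho ^+ j <= 1 by rewrite exprn_ile1.
  have lamj0 : lam j <= lam 0%N by rewrite (le_trans lamj) // ler_piMl.
  have s_le_lam : s <= M * lam j by rewrite ler_wpM2l.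
  have s_le : s <= 3 / 28 * m.
    have : M * lam j <= M * lam 0%N by rewrite ler_wpM2l.
    have : ln (3 / 2 : R) * m <= 3 / 7 * m.
      by rewrite ler_wpM2r ?ln_3_2_le // ltW.
    lra.
  have lamS : lam j.+1 <= rho * lam j.
    rewrite -!lamE xE.
    have := local_grad_norm_quasi_newton_step f_diff2 f_posdef M_ge0 f_ssc
      Gsym HG GH eta1 Gd erefl.
    move=> /le_trans; apply; rewrite lamE; apply: ler_wpM2r => //.
    apply: contraction_factor_le; rewrite ?(ltW m_gt0) // -/s ?s_ge0 //.
    rewrite invf_le1 // eta1 andbT.
    have -> : 2 / 3 * m = (3 / 2 * m^-1)^-1 by field; rewrite gt_eqF.
    by rewrite lef_pV2 // posrE ?mulr_gt0 ?divr_gt0 ?invr_gt0.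
  have Hsym y : self_adjoint (hessian f y) by move=> h q; exact: hessian_sym.
  have tG_sym : self_adjoint ((1 + s) *: G j).
    by move=> h q; rewrite !opformZ Gsym.
  have s1_ge0 : 0 <= 1 + s by rewrite addr_ge0.
  have HtG : loewner_le (hessian f (x j.+1)) ((1 + s) *: G j).
    apply/loewnerP => h; rewrite opformZ.
    have := hessian_next_le f_ssc (x j) (x j.+1) h; rewrite xd -/s.
    move=> /le_trans; apply; rewrite ler_wpM2l //.
    by move/loewnerP: HG; apply.
  have eta_next : (1 + s) ^+ 2 * eta j <= eta j.+1.
    have -> : eta j.+1 = expR (M * lam j) ^+ 2 * eta j.
      rewrite /eta /S big_ord_recr /= -/(S j) -expRM_natl [RHS]mulrA -expRD.
      by congr (expR _ * _); ring.
    rewrite ler_wpM2r ?(ltW eta0) // lerXn2r ?nnegrE ?expR_ge0 //.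
    by rewrite (le_trans _ (expR_ge1Dx _)) // lerD2l.
  have tGH : loewner_le ((1 + s) *: G j) (eta j.+1 *: hessian f (x j.+1)).
    apply/loewnerP => h; rewrite !opformZ.
    have Hh : 0 <= hessian f (x j.+1) h h by exact: posdef_ge0.
    have := hessian_le_next f_ssc (x j) (x j.+1) h; rewrite xd -/s => H1.
    have H2 : G j h h <= eta j * hessian f (x j) h h.
      by rewrite -opformZ; have /loewnerP := GH; apply.
    exact: scaled_chain (ltW eta0) s_ge0 Hh H2 H1 eta_next.
  rewrite xd -/s in GE.
  have [L1 L2] :=
    Broyd_loewner (u j) (f_posdef (x j.+1)) tG_sym (Hsym _) tau01 HtG tGH.
  rewrite GE; split=> //.
  - exact: Broyd_self_adjoint.
  - by rewrite exprS (le_trans lamS) // -mulrA ler_wpM2l.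
  - rewrite /S big_ord_recr /= -/(S j) mulrDr exprS.
    have : m / 2 * lam j <= m / 2 * (rho ^+ j * lam 0%N).
      by rewrite ler_wpM2l // divr_ge0 // ltW.
    rewrite {2}/rho; lra.
have [Gsym HG GH lamk Sk] := inv k.
have /andP[eta1 eta32] := eta_le k Sk.
split=> //; last by rewrite rhoE.
apply/loewnerP => h; rewrite !opformZ ler_wpM2r //; first exact: posdef_ge0.
by rewrite (_ : 3 * L / (2 * mu) = 3 / 2 * m^-1) // /m; field; rewrite !gt_eqF.
Qed.
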